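(* Let $W$ be a homogeneous fully-settled water-at-rest state of the SWEMED1 system $\partial_tW+A(W)\partial_xW=S(W)$, i.e. $W\in\mathcal E_{wr}=\{W\in G: u_m=0,\ \alpha_1=0,\ c_m=0\}$, and let $A=A(W)$ and $S_W(W)=\partial S/\partial W$ be evaluated at this state. For every wave number $\xi\in\mathbb R$, $$\det\left(\lambda I-(S_W(W)-i\xi A)\right)=\lambda\left(\lambda+\frac{\omega_0S_b}{h}\right)\left(\lambda+\frac{12\nu}{h^2}\right)(\lambda^2+gh\xi^2),$$ hence the spectrum is $$\sigma(S_W(W)-i\xi A)=\left\{0,\ -\frac{\omega_0S_b}{h},\ -\frac{12\nu}{h^2},\ \pm i\sqrt{gh}\,\xi\right\},$$ and all eigenvalues have non-positive real part. Thus the linearized system $\partial_t\delta W+A\,\partial_x\delta W=S_W(W)\,\delta W$ has no growing normal modes, i.e. every non-trivial solution of the form $\delta W(t,x)=\widehat We^{\lambda t+i\xi x}$ with $\xi\in\mathbb R$ has $\operatorname{Re}\lambda\le0$.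
   Context: The state is $W=(h,hu_m,h\alpha_1,hc_m,h_b)^T\in\mathbb R^5$, where $h$ is the water height, $u_m$ the mean velocity, $\alpha_1$ the first velocity-moment coefficient, $c_m$ the depth-averaged suspended sediment concentration and $h_b$ the bed elevation. The admissible set is $G=\{W: h>0,\ 0\le c_m\le 1\}$ (the formulas for $A$ and $S$ also make sense in a neighbourhood of $G$). The bottom velocity is $u_b=u_m+\alpha_1$ and the mixture density is $\rho=\rho_w+c_m(\rho_s-\rho_w)$. Transport matrix: $$A(W)=\begin{pmatrix}0&1&0&0&0\\ gh-u_m^2-\frac{\alpha_1^2}{3}-\frac{ghc_m(\rho_s-\rho_w)}{2\rho}&2u_m&\frac{2\alpha_1}{3}&\frac{gh(\rho_s-\rho_w)}{2\rho}&gh\\ -2\alpha_1u_m-\frac{ghc_m(\rho_s-\rho_w)}{2\rho}&2\alpha_1&u_m&\frac{gh(\rho_s-\rho_w)}{2\rho}&0\\ -c_mu_m&c_m&0&u_m&0\\ \delta_h&\delta_q&\delta_q&\delta_c&0\end{pmatrix},$$ $$\delta_q=\frac{24Q}{1-\psi}\operatorname{sgn}(u_b)\frac{\rho\epsilon}{g(\rho_s-\rho_w)d_s}(\theta-\theta_c)_+^{1/2}\frac{u_b}{h},\quad \delta_h=-u_b\left(1+\frac{c_m(\rho_s-\rho_w)}{2\rho}\right)\delta_q,\quad \delta_c=u_b\frac{\rho_s-\rho_w}{2\rho}\delta_q,$$ where $\theta=\frac{\rho\epsilon u_b^2}{g(\rho_s-\rho_w)d_s}$ is the Shields parameter, $(\cdot)_+$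 the positive part, $\theta_c\ge0$ the critical Shields parameter, and $Q>0$ a constant. Source term: $$S(W)=\begin{pmatrix}\frac{E-D}{1-\psi}\\ -\epsilon|u_b|u_b+\frac{E-D}{1-\psi}u_b\\ -3\left(\epsilon|u_b|u_b+4\frac{\nu}{h}\alpha_1\right)+2\frac{E-D}{1-\psi}\alpha_1\\ E-D\\ \frac{D-E}{1-\psi}\end{pmatrix},\qquad E=\omega_0(1-\psi)E_s,\quad D=\omega_0S_bc_m,$$ $$E_s=\frac{1.3\times10^{-7}\mathcal Z^5}{1+4.3\times10^{-7}\mathcal Z^5},\qquad \mathcal Z=\frac{\gamma_1\sqrt{c_D}\,|u_b|}{\omega_0}\mathcal R_p^{\gamma_2}.$$ Constants: $g,\epsilon,\nu,d_s,\omega_0,S_b,c_D,\mathcal R_p>0$, $\rho_s>\rho_w>0$, $\psi\in[0,1)$; $(\gamma_1,\gamma_2)=(1,0.6)$ if $\mathcal R_p>2.36$ and $(0.586,1.23)$ if $\mathcal R_p\le2.36$. *)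

(* Defs.v *)
From HB Require Import structures.
From mathcomp Require Import all_boot all_order all_algebra.
From mathcomp Require Import all_classical all_reals all_analysis.
From mathcomp.real_closed Require Import complex.
Set Implicit Arguments.
Unset Strict Implicit.
Unset Printing Implicit Defensive.
Import Order.TTheory GRing.Theory Num.Theory.
Import numFieldNormedType.Exports.
Local Open Scope classical_set_scope.
Local Open Scope ring_scope.
Local Open Scope complex_scope.

Record swemed_params (R : realType) := SwemedParams {
  grav : R;        (* g *)
  eps : R;         (* friction coefficient epsilon *)
  nu : R;          (* viscosity *)
  dsed : R;        (* sediment diameter d_s *)
  settling : R;    (* settling velocity omega_0 *)
  Sb : R;          (* S_b *)
  cD : R;          (* c_D *)
  Rp : R;          (* particle Reynolds number R_p *)
  rhos : R;        (* sediment density rho_s *)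
  rhow : R;        (* water density rho_w *)
  psi : R;         (* porosity *)
  thetac : R;      (* critical Shields parameter *)
  Qbed : R         (* bed-load constant Q *)
}.

Definition swemed_params_ok (R : realType) (p : swemed_params R) : Prop :=
  [/\ [/\ 0 < grav p, 0 < eps p, 0 < nu p & 0 < dsed p],
      [/\ 0 < settling p, 0 < Sb p, 0 < cD p & 0 < Rp p],
      0 < rhow p /\ rhow p < rhos p,
      0 <= psi p /\ psi p < 1 &
      0 <= thetac p /\ 0 < Qbed p].

Section Swemed.
Context (R : realType) (p : swemed_params R).

(* A state holds the conserved variables (h, h u_m, h alpha_1, h c_m, h_b);
   all other quantities are functions of these.  It is a row vector because
   the library's Jacobian 'J is defined for maps between row vectors. *)
Implicit Types W : 'rV[R]_5.

Definition height W : R := W 0 (inord 0).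
Definition umean W : R := W 0 (inord 1) / height W.
Definition alpha1 W : R := W 0 (inord 2) / height W.
Definition conc W : R := W 0 (inord 3) / height W.

Definition ubot W : R := umean W + alpha1 W.
Definition drho : R := rhos p - rhow p.
Definition density W : R := rhow p + conc W * drho.

Definition shields W : R :=
  density W * eps p * ubot W ^+ 2 / (grav p * drho * dsed p).

Definition delta_q W : R :=
  24%:R * Qbed p / (1 - psi p) * Num.sg (ubot W)
  * (density W * eps p / (grav p * drho * dsed p))
  * Num.sqrt (Num.max (shields W - thetac p) 0)
  * (ubot W / height W).
Definition delta_h W : R :=
  - ubot W * (1 + conc W * drho / (2%:R * density W)) * delta_q W.
Definition delta_c W : R :=
  ubot W * (drho / (2%:R * density W)) * delta_q W.

Definition transport W : 'M[R]_5 :=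
  let g := grav p in let h := height W in
  let u := umean W in let a := alpha1 W in let c := conc W in
  let k := g * h * drho / (2%:R * density W) in
  let kc := g * h * c * drho / (2%:R * density W) in
  let rows : seq (seq R) :=
    [:: [:: 0; 1; 0; 0; 0];
        [:: g * h - u ^+ 2 - a ^+ 2 / 3%:R - kc;
            2%:R * u; 2%:R * a / 3%:R; k; g * h];
        [:: - (2%:R * a * u) - kc; 2%:R * a; u; k; 0];
        [:: - (c * u); c; 0; u; 0];
        [:: delta_h W; delta_q W; delta_q W; delta_c W; 0]] in
  \matrix_(i < 5, j < 5) nth 0 (nth [::] rows i) j.

Definition gamma1 : R := if 236%:R / 100%:R < Rp p then 1 else 586%:R / 1000%:R.
Definition gamma2 : R :=
  if 236%:R / 100%:R < Rp p then 6%:R / 10%:R else 123%:R / 100%:R.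

Definition Zent W : R :=
  gamma1 * Num.sqrt (cD p) * `|ubot W| / settling p * (Rp p `^ gamma2).
(* 13 * 10^-8 = 1.3e-7 and 43 * 10^-8 = 4.3e-7 *)
Definition Es W : R :=
  (13%:R * 10%:R ^- 8 * Zent W ^+ 5) / (1 + 43%:R * 10%:R ^- 8 * Zent W ^+ 5).
Definition entrainment W : R := settling p * (1 - psi p) * Es W.
Definition deposition W : R := settling p * Sb p * conc W.

Definition source W : 'rV[R]_5 :=
  let E := entrainment W in let D := deposition W in let ub := ubot W in
  let F := (E - D) / (1 - psi p) in
  let entries : seq R :=
    [:: F;
        - (eps p * `|ub| * ub) + F * ub;
        - (3%:R * (eps p * `|ub| * ub + 4%:R * (nu p / height W) * alpha1 W))
          + 2%:R * F * alpha1 W;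
        E - D;
        (D - E) / (1 - psi p)] in
  \row_(j < 5) nth 0 entries j.

(* 'J f acts on row vectors from the right, so its (j, i) entry is
   d f_i / d W_j: the usual Jacobian matrix is its transpose. *)
Definition source_jacobian W : 'M[R]_5 := ('J source W)^T.

Definition admissible : set 'rV[R]_5 :=
  [set W | 0 < height W /\ (0 <= conc W /\ conc W <= 1)].

Definition water_at_rest : set 'rV[R]_5 :=
  admissible `&` [set W | [/\ umean W = 0, alpha1 W = 0 & conc W = 0]].

End Swemed.

Section NormalModes.
Context (R : realType).

Definition toC m n (M : 'M[R]_(m, n)) : 'M[R[i]]_(m, n) :=
  map_mx (real_complex R) M.

Definition symbol n (A B : 'M[R]_n) (xi : R) : 'M[R[i]]_n :=
  toC B - ('i%C * xi%:C) *: toC A.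

Definition spectrum n (M : 'M[R[i]]_n) : set R[i] := [set l | eigenvalue M l].

Definition cexp (z : R[i]) : R[i] :=
  (expR (complex.Re z) * cos (complex.Im z))
  +i* (expR (complex.Re z) * sin (complex.Im z)).

(* f : R -> C^n has derivative d at t *)
Definition is_cderive n (f : R -> 'cV[R[i]]_n) (t : R) (d : 'cV[R[i]]_n) : Prop :=
  forall k : 'I_n,
    is_derive t 1 (fun s => complex.Re (f s k 0)) (complex.Re (d k 0)) /\
    is_derive t 1 (fun s => complex.Im (f s k 0)) (complex.Im (d k 0)).

(* classical solution on R x R of d_t U + A d_x U = B U *)
Definition linear_solution n (A B : 'M[R]_n) (U : R -> R -> 'cV[R[i]]_n) : Prop :=
  forall t x : R, exists dt dx : 'cV[R[i]]_n,
    [/\ is_cderive (fun s => U s x) t dt,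
        is_cderive (fun y => U t y) x dx &
        dt + toC A *m dx = toC B *m U t x].

Definition normal_mode n (l : R[i]) (xi : R) (w : 'cV[R[i]]_n) :
    R -> R -> 'cV[R[i]]_n :=
  fun t x => cexp (l * t%:C + 'i%C * xi%:C * x%:C) *: w.

End NormalModes.

(* Main.v *)
Require Import Defs.
From HB Require Import structures.
From mathcomp Require Import all_boot all_order all_algebra.
From mathcomp Require Import all_classical all_reals all_analysis.
From mathcomp.real_closed Require Import complex.
From mathcomp Require Import ring.
Import Order.TTheory GRing.Theory Num.Theory.
Import numFieldNormedType.Exports.
Local Open Scope classical_set_scope.
Local Open Scope ring_scope.
Local Open Scope complex_scope.

(** The source term is not smooth: it contains the absolute value of the
    bottom velocity. It nevertheless factors as [source V = V *m B V] with a
    matrix [B V] that is continuous at a state at rest [W], and such that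
    [W *m B V = 0] for every [V] ([source_factorE], [mul_rest_source_factor]):
    every term of the source has a factor u_b, alpha_1 or c_m, which is 1/h
    times a combination of the conserved variables h u_m, h alpha_1, h c_m that
    vanish at [W]; for the entrainment, |u_b|^5 is read as |u_b|^3 u_b times
    u_b. Hence
    [source (W + v) = v *m B (W + v) = v *m B W + o(v)], so the source is
    differentiable at [W] and its Jacobian is read off [B W]
    ([is_diff_mulmx], [source_jacobian_rest]). Only the settling rate
    omega_0 S_b / h and the viscous rate 12 nu / h^2 survive in it.

    The transport matrix at rest is sparse too, since the bed-load coefficients
    carry a factor u_b. In the symbol, the sediment equation and then the
    alpha_1 equation decouple, giving the two decay rates; the
    remaining variables (h, h u_m, h_b) form a 3 by 3 block of determinant
    l (l^2 + g h xi^2), made of the bed mode and the two gravity waves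
    ([det_symbol_rest]).

    Finally, a normal mode that solves the linearized system has as amplitude
    an eigenvector of the symbol ([normal_mode_eigenvector]), so its growth rate
    is a root of that determinant. *)

Set Implicit Arguments.
Unset Strict Implicit.

(** * Differentiating a product with a continuous matrix factor *)

Lemma norm_mulmx_le (R : realFieldType) m n (v : 'rV[R]_m) (M : 'M[R]_(m, n)) :
  `|v *m M| <= m%:R * `|M| * `|v|.
Proof.
have entry_le p q (N : 'M[R]_(p, q)) i j : `|N i j| <= `|N|.
  rewrite [leRHS]/Num.Def.normr/= mx_normrE.
  exact: le_trans (le_bigmax _ (fun ij : 'I_p * 'I_q => `|N ij.1 ij.2|) (i, j)).
rewrite [leLHS]/Num.Def.normr/= mx_normrE.
apply: bigmax_le => [|[i j] _ /=]; first by rewrite !mulr_ge0.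
rewrite mxE (le_trans (ler_norm_sum _ _ _))//.
have -> : m%:R * `|M| * `|v| = \sum_(k < m) `|M| * `|v|.
  by rewrite sumr_const card_ord -mulrA mulr_natl.
by apply: ler_sum => k _; rewrite normrM mulrC ler_pM.
Qed.

Lemma continuous_mulmxr (R : realFieldType) m n (M : 'M[R]_(m, n)) :
  continuous (mulmxr M : 'rV[R]_m -> 'rV[R]_n).
Proof.
apply/(linear_bounded_continuous (mulmxr M : {linear 'rV[R]_m -> 'rV[R]_n})).
apply/linear_boundedP; near=> r => v /=.
apply: le_trans (norm_mulmx_le _ _) _.
by rewrite ler_wpM2r.
Unshelve. all: by end_near. Qed.

Lemma continuous_mx_entries (R : realFieldType) (V : topologicalType) m n
    (B : V -> 'M[R]_(m, n)) (x : V) :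
  (forall i j, {for x, continuous (fun y => B y i j)}) -> {for x, continuous B}.
Proof.
move=> Bx; apply/cvgrPdist_le => /= e e0; near=> y.
rewrite /Num.Def.normr/= mx_normrE (bigmax_le _ (ltW e0))//= => i _.
rewrite !mxE; move: i; near: y; apply: filter_forall => /= i.
exact: (cvgrPdist_le _ _).1 (Bx i.1 i.2) _ e0.
Unshelve. all: by end_near. Qed.

(** At [W + v] the function is [v *m B (W + v)], and by continuity of [B]
    replacing [B (W + v)] by [B W] costs
    [v *m (B (W + v) - B W) = o(v)]. *)
Lemma is_diff_mulmx (R : realType) m n (B : 'rV[R]_m -> 'M[R]_(m, n))
    (W : 'rV[R]_m) :
  {for W, continuous B} -> (forall V, W *m B V = 0) ->
  is_diff W (fun V => V *m B V) (mulmxr (B W)).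
Proof.
move=> Bc WB.
have expansion : (fun V : 'rV[R]_m => V *m B V) \o shift W =
   cst (W *m B W) + (mulmxr (B W)) +o_ (0 : 'rV[R]_m) id.
  apply/eqaddoP => _/posnumP[e].
  have Be : \forall v \near (0 : 'rV[R]_m),
      `|B W - B (v + W)| <= e%:num / m.+1%:R.
    rewrite (near_shift W) sub0r; near=> y; rewrite /= subrK; near: y.
    by move/cvgrPdist_le : Bc; apply; rewrite divr_gt0.
  near=> v.
  rewrite -![(_ + _ : _ -> _) _]/(_ + _) -![(- _ : _ -> _) _]/(- _) /=.
  rewrite -![(_ + _ : _ -> _) _]/(_ + _) /cst /=.
  rewrite mulmxDl !WB addr0 add0r -mulmxBr.
  apply: le_trans (norm_mulmx_le _ _) _.
  rewrite ler_wpM2r//; apply: le_trans (_ : m.+1%:R * `|B (v + W) - B W| <= _).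
    by rewrite ler_wpM2r// ler_nat.
  rewrite mulrC -ler_pdivlMr ?ltr0n// -normrN opprB.
  by near: v.
have dW := @continuous_mulmxr R m n (B W).
apply: DiffDef; last exact: diff_unique.
apply/diff_locallyP.
have -> : 'd (fun V : 'rV[R]_m => V *m B V) W = mulmxr (B W) :> (_ -> _).
  exact: diff_unique.
by split.
Unshelve. all: by end_near. Qed.

(** * The source term near a state at rest *)

(** The shape shared by the matrix [B V] of the factorization and by its value
    at rest: the rows are indexed by the conserved variables, the columns by
    the equations. The rows of h and h_b vanish, since the source depends on
    these two variables only through the coefficients. *)
Definition factor_pattern (R : realType) (q e s a b c : R) : 'M[R]_5 :=
  \matrix_(i < 5, j < 5) nth 0 (nth [::]
    [:: [:: 0; 0; 0; 0; 0];
        [:: e * q; a; b; e; - (e * q)];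
        [:: e * q; a; c; e; - (e * q)];
        [:: - (s * q); 0; 0; - s; s * q];
        [:: 0; 0; 0; 0; 0]] i) j.

Lemma continuous_factor_pattern (R : realType) (V : topologicalType) (x : V)
    (q : R) (e s a b c : V -> R) :
  {for x, continuous e} -> {for x, continuous s} -> {for x, continuous a} ->
  {for x, continuous b} -> {for x, continuous c} ->
  {for x, continuous
    (fun y => factor_pattern q (e y) (s y) (a y) (b y) (c y))}.
Proof.
move=> ec sc ac bc cc.
have c0 : {for x, continuous (fun _ : V => 0 : R)} by exact: cst_continuous.
have cN (f : V -> R) :
  {for x, continuous f} -> {for x, continuous (fun y => - f y)}.
  exact: continuousN.
have cq (f : V -> R) :
  {for x, continuous f} -> {for x, continuous (fun y => f y * q)}.
  by move=> fc; apply: (continuousM fc); exact: cst_continuous.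
apply: continuous_mx_entries => i j.
have -> : (fun y => factor_pattern q (e y) (s y) (a y) (b y) (c y) i j) =
    fun y => nth 0 (nth [::]
      [:: [:: 0; 0; 0; 0; 0];
          [:: e y * q; a y; b y; e y; - (e y * q)];
          [:: e y * q; a y; c y; e y; - (e y * q)];
          [:: - (s y * q); 0; 0; - s y; s y * q];
          [:: 0; 0; 0; 0; 0]] i) j.
  by apply/funext => y; rewrite mxE.
by case: i j => -[|[|[|[|[|i]]]]] /= _ [[|[|[|[|[|j]]]]] /= _];
  rewrite ?nth_nil; first [assumption | by apply: (cq) | by apply: (cN)
                          | by apply: (cN); apply: (cq)].
Qed.

Section Source.
Context (R : realType) (p : swemed_params R).
Implicit Types V W : 'rV[R]_5.

(** The ratio of [Zent p V] to the absolute value of the bottom velocity. *)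
Definition Zslope : R :=
  gamma1 p * Num.sqrt (cD p) / settling p * (Rp p `^ gamma2 p).

Definition entrainment_factor V : R :=
  settling p * (1 - psi p)
  * (13%:R * 10%:R ^- 8 * Zslope ^+ 5 * `|ubot V| ^+ 3 * ubot V
     / (1 + 43%:R * 10%:R ^- 8 * Zent p V ^+ 5)).

Definition source_factor V : 'M[R]_5 :=
  let h := height V in
  let r := - (eps p * `|ubot V|) / h in
  let F := (entrainment p V - deposition p V) / (1 - psi p) in
  factor_pattern (1 - psi p)^-1
    (entrainment_factor V / h) (settling p * Sb p / h)
    (r + F / h) (3%:R * r)
    (3%:R * r - 12%:R * nu p / h ^+ 2 + 2%:R * F / h).

Lemma mulmx5E V (M : 'M[R]_5) j :
  (V *m M) 0 j = V 0 (inord 0) * M (inord 0) j + V 0 (inord 1) * M (inord 1) j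
    + V 0 (inord 2) * M (inord 2) j + V 0 (inord 3) * M (inord 3) j
    + V 0 (inord 4) * M (inord 4) j.
Proof.
rewrite mxE !big_ord_recl big_ord0 addr0 !addrA.
by do ![congr (_ + _)]; congr (V 0 _ * M _ j); apply/val_inj; rewrite /= inordK.
Qed.

Lemma entrainmentE V : entrainment p V = entrainment_factor V * ubot V.
Proof.
have n2 : `|ubot V| ^+ 2 = ubot V ^+ 2 by rewrite real_normK ?num_real.
have Z5 : Zent p V ^+ 5 = Zslope ^+ 5 * `|ubot V| ^+ 3 * ubot V ^+ 2.
  by rewrite -n2 /Zent /Zslope; ring.
rewrite /entrainment /entrainment_factor /Es {1}Z5; ring.
Qed.

(** A polynomial identity in which 1/h and the denominator of the entrainment
    are atoms. *)
Lemma source_factorE V : source p V = V *m source_factor V.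
Proof.
apply/rowP => j; rewrite mulmx5E !mxE !inordK//=.
(* [exprVn] writes the inverse of h^2 as a power of h^-1, an atom for [ring]. *)
case: j => -[|[|[|[|[|//]]]]] ? /=; rewrite /source_factor ?entrainmentE
  /deposition /conc /ubot /umean /alpha1 -?exprVn; ring.
Qed.

Lemma rest_ubot W : water_at_rest W -> ubot W = 0.
Proof. by move=> [_ [um al _]]; rewrite /ubot um al addr0. Qed.

Lemma continuous_source_factor W :
  water_at_rest W -> {for W, continuous source_factor}.
Proof.
move=> rest; have h0 : 0 < height W by case: rest => -[].
have u0 := rest_ubot rest.
have kc (c : R) : {for W, continuous (fun=> c)} by exact: cst_continuous.
have coordc k : {for W, continuous (fun V : 'rV[R]_5 => V 0 (inord k))}.
  exact: coord_continuous.
have Xc n (f : 'rV[R]_5 -> R) : {for W, continuous f} ->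
    {for W, continuous (fun V => f V ^+ n)}.
  by move=> fc; exact: (continuous_comp fc (@exprn_continuous R n (f W))).
have hc : {for W, continuous (fun V => height V)} by exact: coordc.
have hV : {for W, continuous (fun V => (height V)^-1)}.
  by apply: continuousV => //; rewrite gt_eqF.
have hV2 : {for W, continuous (fun V => (height V ^+ 2)^-1)}.
  by apply: continuousV; [rewrite expf_neq0// gt_eqF | exact: Xc].
have uc : {for W, continuous (fun V => ubot V)}.
  exact: (continuousD (continuousM (coordc 1) hV) (continuousM (coordc 2) hV)).
have nc : {for W, continuous (fun V => `|ubot V|)} by apply: (cvg_norm uc).
have Zc : {for W, continuous (fun V => Zent p V)}.
  exact: (continuousM
    (continuousM (continuousM (kc _) nc) (kc _)) (kc _)).
have ec : {for W, continuous (fun V => entrainment_factor V)}.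
  apply: (continuousM (kc _) (continuousM
    (continuousM (continuousM (kc _) (Xc 3 _ nc)) uc) _)).
  apply: continuousV.
    by rewrite /Zent u0 normr0 !(mulr0, mul0r) expr0n /= mulr0 addr0 oner_eq0.
  exact: (continuousD (kc _) (continuousM (kc _) (Xc 5 _ Zc))).
have Ec : {for W, continuous (fun V => entrainment p V)}.
  have -> : entrainment p = fun V => entrainment_factor V * ubot V.
    by apply/funext => V; exact: entrainmentE.
  exact: (continuousM ec uc).
have Dc : {for W, continuous (fun V => deposition p V)}.
  exact: (continuousM (kc _) (continuousM (coordc 3) hV)).
have rc : {for W, continuous (fun V => - (eps p * `|ubot V|) / height V)}.
  exact: (continuousM (continuousN (continuousM (kc _) nc)) hV).
have Fc : {for W, continuous
    (fun V => (entrainment p V - deposition p V) / (1 - psi p))}.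
  exact: (continuousM (continuousB Ec Dc) (kc _)).
have r3c : {for W, continuous
    (fun V => 3%:R * (- (eps p * `|ubot V|) / height V))}.
  exact: (continuousM (kc _) rc).
apply: continuous_factor_pattern.
- exact: (continuousM ec hV).
- exact: (continuousM (kc _) hV).
- exact: (continuousD rc (continuousM Fc hV)).
- exact: r3c.
- apply: (continuousD (continuousB r3c (continuousM (kc _) hV2))).
  exact: (continuousM (continuousM (kc _) Fc) hV).
Qed.

Lemma source_factor_rest W : water_at_rest W ->
  source_factor W = factor_pattern (1 - psi p)^-1
    0 (settling p * Sb p / height W) 0 0 (- (12%:R * nu p / height W ^+ 2)).
Proof.
move=> rest; have u0 := rest_ubot rest; case: rest => _ [_ _ c0].
rewrite /source_factor entrainmentE /deposition c0 /entrainment_factor u0.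
by rewrite normr0 /= !(mulr0, mul0r, subr0, oppr0, addr0, add0r).
Qed.

Lemma mul_rest_source_factor W V : water_at_rest W -> W *m source_factor V = 0.
Proof.
move=> [[h0 _] [u0 a0 c0]].
have e0 k : W 0 (inord k) / height W = 0 -> W 0 (inord k) = 0.
  by move/eqP; rewrite mulf_eq0 invr_eq0 (gt_eqF h0) orbF => /eqP.
apply/rowP => j; rewrite mulmx5E (e0 _ u0) (e0 _ a0) (e0 _ c0) !mxE !inordK//=.
by case: j => -[|[|[|[|[|//]]]]] ? /=; rewrite !(mul0r, mulr0, addr0).
Qed.

Lemma is_diff_source_rest W :
  water_at_rest W -> is_diff W (source p) (mulmxr (source_factor W)).
Proof.
move=> rest; have -> : source p = fun V => V *m source_factor V.
  by apply/funext => V; exact: source_factorE.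
apply: is_diff_mulmx; first exact: continuous_source_factor.
by move=> V; exact: mul_rest_source_factor.
Qed.

Lemma source_jacobian_rest W : water_at_rest W ->
  source_jacobian p W = (factor_pattern (1 - psi p)^-1
    0 (settling p * Sb p / height W) 0 0
    (- (12%:R * nu p / height W ^+ 2)))^T.
Proof.
move=> rest; rewrite /source_jacobian /jacobian -source_factor_rest//.
have [_ dE] := is_diff_source_rest rest.
congr (_^T); apply/row_matrixP => i.
by rewrite !rowE mul_rV_lin1 /= dE.
Qed.

End Source.

(** * The characteristic determinant of the symbol *)

(** The fourth row is zero off its diagonal, and so is the third one once the
    fourth row and column are removed; the fifth row then splits off in the
    same way. *)
Lemma det_rest_pattern (K : comRingType) (l a b d v x y z w : K) :
  \det (\matrix_(i < 5, j < 5) nth 0 (nth [::]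
    [:: [:: l; a; 0; x; 0];
        [:: b; l; 0; y; b];
        [:: 0; 0; v; z; 0];
        [:: 0; 0; 0; d; 0];
        [:: 0; 0; 0; w; l]] i) j) = l * d * v * (l ^+ 2 - a * b).
Proof.
pose i3 := Ordinal (isT : 3 < 5)%N.
rewrite (expand_det_row _ i3) (bigD1 i3) //=.
rewrite big1 ?addr0; last first.
  by case=> -[|[|[|[|[|//]]]]] ? //= _; rewrite !mxE /= mul0r.
rewrite /cofactor !mxE /=.
do 3![rewrite !(expand_det_row _ ord0, big_ord_recl, big_ord0, mxE) /=;
      rewrite ?(mul0r, add0r, addr0) /cofactor].
rewrite ?(det_mx11, mxE) /= /bump /=.
ring.
Qed.

Lemma det_symbol_rest (R : realType) (p : swemed_params R) (W : 'rV[R]_5)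
    (xi : R) (l : R[i]) : water_at_rest W ->
  \det (l%:M - symbol (transport p W) (source_jacobian p W) xi) =
  l * (l + (settling p * Sb p / height W)%:C)
    * (l + (12%:R * nu p / height W ^+ 2)%:C)
    * (l ^+ 2 + (grav p * height W * xi ^+ 2)%:C).
Proof.
move=> rest; rewrite source_jacobian_rest//.
have u0 := rest_ubot rest; case: rest => _ [um0 al0 c0].
set h := height W.
set s := settling p * Sb p / h; set v := 12%:R * nu p / h ^+ 2.
pose ixi : R[i] := 'i%C * xi%:C.
pose k := ixi * (grav p * h * drho p / (2%:R * density p W))%:C.
have -> : l%:M - symbol (transport p W)
    (factor_pattern (1 - psi p)^-1 0 s 0 0 (- v))^T xi =
  \matrix_(i < 5, j < 5) nth 0 (nth [::]
    [:: [:: l; ixi; 0; (s / (1 - psi p))%:C; 0];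
        [:: ixi * (grav p * h)%:C; l; 0; k; ixi * (grav p * h)%:C];
        [:: 0; 0; l + v%:C; k; 0];
        [:: 0; 0; 0; l + s%:C; 0];
        [:: 0; 0; 0; - (s / (1 - psi p))%:C; l]] i) j.
  have dq0 : delta_q p W = 0 by rewrite /delta_q u0 mul0r mulr0.
  apply/matrixP => i j; rewrite !mxE.
  rewrite /delta_h /delta_c dq0 um0 al0 c0 -/h.
  by case: i j => -[|[|[|[|[|//]]]]] ? [[|[|[|[|[|//]]]]] ?] /=;
    rewrite /k /ixi ?mulr1n ?mulr0n; ring.
rewrite det_rest_pattern.
have -> : (grav p * h * xi ^+ 2)%:C = (grav p * h)%:C * xi%:C ^+ 2.
  by rewrite rmorphM rmorphXn.
have -> : ixi * (ixi * (grav p * h)%:C) =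
    'i%C ^+ 2 * xi%:C ^+ 2 * (grav p * h)%:C by rewrite /ixi; ring.
rewrite sqr_i; ring.
Qed.

Lemma eigenvalue_det (K : fieldType) n (M : 'M[K]_n) (l : K) :
  eigenvalue M l = (\det (l%:M - M) == 0).
Proof.
apply/eigenvalueP/det0P => [[v vM v0] | [v v0 vM]]; exists v => //.
  by rewrite mulmxBr mul_mx_scalar vM subrr.
by apply/esym/eqP; rewrite -subr_eq0 -mul_mx_scalar -mulmxBr vM.
Qed.

(** * The roots *)

Lemma rest_rootsE (R : realType) (s v g xi : R) (l : R[i]) : 0 <= g ->
  l * (l + s%:C) * (l + v%:C) * (l ^+ 2 + (g * xi ^+ 2)%:C) = 0 <->
  [set 0; - s%:C; - v%:C; 'i%C * (Num.sqrt g * xi)%:C;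
       - ('i%C * (Num.sqrt g * xi)%:C)] l.
Proof.
move=> g0; set r := Num.sqrt g * xi.
have -> : g * xi ^+ 2 = r ^+ 2 by rewrite exprMn sqr_sqrtr.
have -> : l ^+ 2 + (r ^+ 2)%:C = (l - 'i%C * r%:C) * (l + 'i%C * r%:C).
  by rewrite -subr_sqr rmorphXn /= [X in _ - X]exprMn sqr_i; ring.
rewrite /=; split=> [/eqP|].
  rewrite !mulf_eq0 !addr_eq0 opprK -!orbA.
  by case/or4P => [||| /orP[]] /eqP ->; tauto.
case=> [[[[]|]|]|] ->; ring.
Qed.

Lemma Re_rest_roots_le0 (R : realType) (s v r : R) (l : R[i]) :
  0 <= s -> 0 <= v ->
  [set 0; - s%:C; - v%:C; 'i%C * r%:C; - ('i%C * r%:C)] l -> complex.Re l <= 0.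
Proof.
move=> s0 v0 [[[[]|]|]|] -> /=;
  by rewrite ?oppr_le0 ?mul0r ?mul1r ?mulr0 ?subrr ?oppr0.
Qed.

(** * Normal modes *)

Lemma is_cderive_exp (R : realType) n (z : R[i]) (w : 'cV[R[i]]_n) :
  is_cderive (fun s : R => cexp (z * s%:C) *: w) 0 (z *: w).
Proof.
case: z => a b k; rewrite !mxE; case wE : (w k 0) => [c d] /=.
have dE (t u : R) : is_derive (0 : R) (1 : R) (fun s : R =>
   expR (a * s) * cos (b * s) * t + expR (a * s) * sin (b * s) * u)
   (a * t + b * u).
  apply: is_derive_eq.
  rewrite !mulr0 expR0 cos0 sin0 /GRing.scale /=; ring.
split.
- have -> :
    (fun s : R => complex.Re ((cexp ((a +i* b) * s%:C) *: w) k 0)) =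
    (fun s => expR (a * s) * cos (b * s) * c
              + expR (a * s) * sin (b * s) * - d).
    apply/funext => s; rewrite mxE wE /cexp /= !mulr0 subr0 add0r; ring.
  apply: is_derive_eq; ring.
- have -> :
    (fun s : R => complex.Im ((cexp ((a +i* b) * s%:C) *: w) k 0)) =
    (fun s => expR (a * s) * cos (b * s) * d + expR (a * s) * sin (b * s) * c).
    apply/funext => s; rewrite mxE wE /cexp /= !mulr0 subr0 add0r; ring.
  exact: dE.
Qed.

Lemma is_cderive_unique (R : realType) n (f : R -> 'cV[R[i]]_n) t d e :
  is_cderive f t d -> is_cderive f t e -> d = e.
Proof.
move=> fd fe; apply/matrixP => k j; rewrite ord1.
case: (fd k) (fe k) => [[_ red] [_ imd]] [[_ ree] [_ ime]].
by apply/eqP; rewrite eq_complex -red -ree -imd -ime !eqxx.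
Qed.

(** It suffices to read the equation at the origin, where the exponential
    is 1 and the two derivatives multiply the amplitude by [l] and by i xi. *)
Lemma normal_mode_eigenvector (R : realType) n (A B : 'M[R]_n) (l : R[i])
    (xi : R) (w : 'cV[R[i]]_n) :
  linear_solution A B (normal_mode l xi w) -> symbol A B xi *m w = l *: w.
Proof.
move=> /(_ 0 0) [dt [dx [wt wx]]].
have cexp0 : cexp (0 : R[i]) = 1 by rewrite /cexp /= expR0 cos0 sin0 mulr1 mulr0.
have -> : dt = l *: w.
  apply: is_cderive_unique wt _.
  have -> : (fun s => normal_mode l xi w s 0) = fun s => cexp (l * s%:C) *: w.
    by apply/funext => s; rewrite /normal_mode mulr0 addr0.
  exact: is_cderive_exp.
have -> : dx = ('i%C * xi%:C) *: w.
  apply: is_cderive_unique wx _.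
  have -> : (fun s => normal_mode l xi w 0 s) =
      fun s => cexp ('i%C * xi%:C * s%:C) *: w.
    by apply/funext => s; rewrite /normal_mode mulr0 add0r.
  exact: is_cderive_exp.
rewrite /normal_mode !mulr0 addr0 cexp0 scale1r => eq_w.
by rewrite /symbol mulmxBl -eq_w -scalemxAl -scalemxAr addrK.
Qed.

Lemma normal_mode_det (R : realType) n (A B : 'M[R]_n) (l : R[i]) (xi : R)
    (w : 'cV[R[i]]_n) :
  normal_mode l xi w <> (fun _ _ => 0) ->
  linear_solution A B (normal_mode l xi w) -> \det (l%:M - symbol A B xi) = 0.
Proof.
move=> w_neq0 /normal_mode_eigenvector Mw; apply/eqP; rewrite -det_tr.
apply/det0P; exists w^T.
  apply: contra_notN w_neq0 => /eqP w0; apply/funext => t; apply/funext => x.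
  by rewrite /normal_mode -[w]trmxK w0 trmx0 scaler0.
by rewrite -trmx_mul mulmxBl mul_scalar_mx Mw subrr trmx0.
Qed.

(** * Stability of the state at rest *)

Theorem mainTheorem5 (R : realType) (p : swemed_params R)
    (hp : swemed_params_ok p) (W : 'rV[R]_5) (hW : water_at_rest W) :
  let A := transport p W in
  let SW := source_jacobian p W in
  let h := height W in
  [/\ differentiable (source p) W,
      (forall xi : R,
        [/\ (forall l : R[i],
               \det (l%:M - symbol A SW xi) =
               l * (l + (settling p * Sb p / h)%:C)
                 * (l + (12%:R * nu p / h ^+ 2)%:C)
                 * (l ^+ 2 + (grav p * h * xi ^+ 2)%:C)),
            spectrum (symbol A SW xi) =
              [set 0;
                   - (settling p * Sb p / h)%:C;
                   - (12%:R * nu p / h ^+ 2)%:C;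
                   'i%C * (Num.sqrt (grav p * h) * xi)%:C;
                   - ('i%C * (Num.sqrt (grav p * h) * xi)%:C)] &
            forall l : R[i], spectrum (symbol A SW xi) l -> complex.Re l <= 0]) &
      (forall (l : R[i]) (xi : R) (w : 'cV[R[i]]_5),
         normal_mode l xi w <> (fun _ _ => 0) ->
         linear_solution A SW (normal_mode l xi w) ->
         complex.Re l <= 0)].
Proof.
move=> A SW h.
have h0 : 0 < h by case: hW => -[].
case: hp => -[/ltW g0 _ /ltW nu0 _] [/ltW o0 /ltW S0 _ _] _ _ _.
have s0 : 0 <= settling p * Sb p / h by rewrite divr_ge0 ?mulr_ge0// ltW.
have v0 : 0 <= 12%:R * nu p / h ^+ 2 by rewrite divr_ge0 ?sqr_ge0 ?mulr_ge0.
have gh0 : 0 <= grav p * h by rewrite mulr_ge0// ltW.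
have detE xi l := det_symbol_rest p xi l hW.
have roots xi l := rest_rootsE (settling p * Sb p / h) (12%:R * nu p / h ^+ 2)
  xi l gh0.
have specE xi l :
  spectrum (symbol A SW xi) l <-> \det (l%:M - symbol A SW xi) = 0.
  by rewrite /spectrum /= eigenvalue_det; split=> /eqP.
split.
- by have [] := is_diff_source_rest p hW.
- move=> xi; split=> [l||l]; first exact: detE.
  + apply/seteqP; split=> l; first by move/specE; rewrite detE => /roots.
    by move/roots; rewrite -detE => /specE.
  + move/specE; rewrite detE => /roots; exact: Re_rest_roots_le0.
- move=> l xi w w_neq0 /(normal_mode_det w_neq0); rewrite detE => /roots.
  exact: Re_rest_roots_le0.
Qed.
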